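(* Fix a time $t$ and consider a junction with incoming roads $1,\ldots,n$ and outgoing roads $n+1,\ldots,n+m$, with the $\alpha$-outside Godunov fluxes. Assume that for each $i\in\{1,\ldots,n\}$ one of the following conditions is satisfied: 1. $u_{hi}^-(b_i)\ge u_*$ and $u_{hj}^+(a_j)\le u_*$ for all $j\in\{n+1,\ldots,n+m\}$. 2. $u_{hi}^-(b_i)<u_*$ and $u_{hj}^+(a_j)\le\tilde{u}$ for all $j\in\{n+1,\ldots,n+m\}$, where $\tilde{u}>u_*$ is such that $f(\tilde{u})=f(u_{hi}^-(b_i))$ (so $\tilde u$ may depend on $i$). Then $E_j=0$ for all $j\in\{n+1,\ldots,n+m\}$.
   Context: Junction: $n,m\ge 1$; each road $k\in\{1,\ldots,n+m\}$ is an interval $[a_k,b_k]$; roads $1,\ldots,n$ are incoming (the junction is at their right endpoint $b_i$) and roads $n+1,\ldots,n+m$ are outgoing (the junction is at their left endpoint $a_j$). The traffic distribution coefficients $\alpha_{j,i}$ ($i=1,\ldots,n$, $j=n+1,\ldots,n+m$) satisfy $0\le\alpha_{j,i}\le1$ and $\sum_{j=n+1}^{n+m}\alpha_{j,i}=1$ for every $i$. Discrete densities: $u_{hk}$ is the discrete (DG) density on road $k$, at each time a piecewise polynomial function on $[a_k,b_k]$ with respect to a finite partition of $[a_k,b_k]$. The time $t$ is fixed and omitted from the notation. $u_{hi}^-(b_i)$ is the left-sided limit of $u_{hi}$ at $b_i$ and $u_{hj}^+(a_j)$ is the right-sided limit of $u_{hj}$ at $a_j$. Flux: $f\in C^1(\mathbb{R})$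 has a global maximum at $u_*$, is non-decreasing on $(-\infty,u_*]$ and non-increasing on $[u_*,\infty)$. Set $f_{in}(u^-)=f(u^-)$ if $u^-<u_*$ and $f_{in}(u^-)=f(u_* )$ if $u^-\ge u_*$; $f_{out}(u^+)=f(u_* )$ if $u^+\le u_*$ and $f_{out}(u^+)=f(u^+)$ if $u^+>u_*$. The Godunov flux is $H(u^-,u^+)=\min\{f_{in}(u^-),f_{out}(u^+)\}$. $\alpha$-outside Godunov junction fluxes: $H_j=\sum_{i=1}^n\alpha_{j,i}H(u_{hi}^-(b_i),u_{hj}^+(a_j))$ for $j=n+1,\ldots,n+m$ and $H_i=\sum_{j=n+1}^{n+m}\alpha_{j,i}H(u_{hi}^-(b_i),u_{hj}^+(a_j))$ for $i=1,\ldots,n$. Traffic distribution error: $E_j=H_j-\sum_{i=1}^n\alpha_{j,i}H_i$ for $j=n+1,\ldots,n+m$. *)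

(* Defs.v *)
From HB Require Import structures.
From mathcomp Require Import all_boot all_order all_algebra.
From mathcomp Require Import all_classical all_reals all_analysis.
Set Implicit Arguments.
Unset Strict Implicit.
Unset Printing Implicit Defensive.
Import Order.TTheory GRing.Theory Num.Theory.
Import numFieldNormedType.Exports.
Local Open Scope classical_set_scope.
Local Open Scope ring_scope.

(* The values of u at the nodes of the partition are left unconstrained: a
   discontinuous Galerkin function is two-valued there, and only its one-sided
   limits matter.  The nodes are a :: s, and s is nonempty as soon as a < b. *)
Definition piecewise_polynomial (R : realType) (a b : R) (u : R -> R) : Prop :=
  exists2 s : seq R, itv_partition a b s &
    forall k, (k < size s)%N ->
      exists p : {poly R},
        {in `](nth a (a :: s) k), (nth a (a :: s) k.+1)[, forall x, u x = p.[x]}.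

(* lim is total; these limits do exist at the endpoints of an interval on which
   u is piecewise polynomial. *)
Definition left_trace (R : realType) (u : R -> R) (b : R) : R :=
  lim (u x @[x --> b^'-]).

Definition right_trace (R : realType) (u : R -> R) (a : R) : R :=
  lim (u x @[x --> a^'+]).

Definition traffic_flux (R : realType) (f : R -> R) (us : R) : Prop :=
  [/\ (forall x, derivable f x 1) /\ continuous (derive1 f),
      forall x, f x <= f us,
      {in `]-oo, us] &, {homo f : x y / x <= y}} &
      {in `[us, +oo[ &, {homo f : x y / x <= y >-> y <= x}}].

Definition f_in (R : realType) (f : R -> R) (us v : R) : R :=
  if v < us then f v else f us.

Definition f_out (R : realType) (f : R -> R) (us v : R) : R :=
  if v <= us then f us else f v.

Definition godunov (R : realType) (f : R -> R) (us vl vr : R) : R :=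
  Num.min (f_in f us vl) (f_out f us vr).

Section Junction.

(* Roads are indexed by 'I_(n + m): the incoming ones are lshift m i for
   i : 'I_n, the outgoing ones rshift n j for j : 'I_m.  The coefficient
   alpha j i is the share of the traffic of incoming road i sent to outgoing
   road j.  Road k is the interval [a k, b k], and u k is the discrete density
   on it at the fixed time. *)
Variables (R : realType) (n m : nat).
Variables (alpha : 'I_m -> 'I_n -> R) (f : R -> R) (us : R).
Variables (a b : 'I_(n + m) -> R) (u : 'I_(n + m) -> R -> R).

Definition traffic_distribution : Prop :=
  (forall j i, 0 <= alpha j i <= 1) /\ (forall i, \sum_(j < m) alpha j i = 1).

Definition trace_in (i : 'I_n) : R :=
  left_trace (u (lshift m i)) (b (lshift m i)).

Definition trace_out (j : 'I_m) : R :=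
  right_trace (u (rshift n j)) (a (rshift n j)).

Definition flux_out (j : 'I_m) : R :=
  \sum_(i < n) alpha j i * godunov f us (trace_in i) (trace_out j).

Definition flux_in (i : 'I_n) : R :=
  \sum_(j < m) alpha j i * godunov f us (trace_in i) (trace_out j).

Definition distribution_error (j : 'I_m) : R :=
  flux_out j - \sum_(i < n) alpha j i * flux_in i.

End Junction.

(* Main.v *)
(* Under either condition outgoing road j can receive all that incoming road i
   sends, so the Godunov flux from i to j is f_in at i, whatever j is.  Since the
   alpha j i sum to 1 over j, the flux leaving road i is that same value, and the
   two sums in E_j agree term by term. *)
Require Import Defs.
From HB Require Import structures.
From mathcomp Require Import all_boot all_order all_algebra.
From mathcomp Require Import all_classical all_reals all_analysis.
Import Order.TTheory GRing.Theory Num.Theory.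
Import numFieldNormedType.Exports.
Local Open Scope ring_scope.

Lemma godunov_free_flow (R : realType) (f : R -> R) (us vl vr : R) :
  f_in f us vl <= f_out f us vr -> godunov f us vl vr = f_in f us vl.
Proof. exact: min_idPl. Qed.

Lemma f_in_le_max (R : realType) (f : R -> R) (us v : R) :
  traffic_flux f us -> f_in f us v <= f us.
Proof. by case=> _ fmax _ _; rewrite /f_in; case: ifP. Qed.

(** Up to [us], [f_out] is the maximum of [f]; between [us] and [ut] it is [f] itself, which is
    non-increasing there and so still at least [f ut]. *)
Lemma f_out_ge (R : realType) (f : R -> R) (us ut v : R) :
  traffic_flux f us -> us < ut -> v <= ut -> f ut <= f_out f us v.
Proof.
case=> _ fmax _ fdecr us_ut v_ut; rewrite /f_out.
case: (leP v us) => [//|us_v].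
by apply: fdecr; rewrite ?in_itv ?andbT //= ltW.
Qed.

Lemma distribution_error_eq0 (R : realType) (n m : nat)
    (alpha : 'I_m -> 'I_n -> R) (f : R -> R) (us : R)
    (a b : 'I_(n + m) -> R) (u : 'I_(n + m) -> R -> R) (c : 'I_n -> R) :
  traffic_distribution alpha ->
  (forall i j, godunov f us (trace_in b u i) (trace_out a u j) = c i) ->
  forall j, distribution_error alpha f us a b u j = 0.
Proof.
move=> [_ alpha1] godE j; apply/eqP; rewrite subr_eq0; apply/eqP.
apply: eq_bigr => i _; congr (_ * _); rewrite godE /flux_in.
under eq_bigr do rewrite godE.
by rewrite -mulr_suml alpha1 mul1r.
Qed.

Theorem theorem2 (R : realType) (n m : nat) (n_ge1 : (1 <= n)%N)
    (m_ge1 : (1 <= m)%N)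
    (a b : 'I_(n + m) -> R) (ab : forall k, a k < b k)
    (alpha : 'I_m -> 'I_n -> R) (alphaP : traffic_distribution alpha)
    (f : R -> R) (us : R) (fP : traffic_flux f us)
    (u : 'I_(n + m) -> R -> R)
    (uP : forall k, piecewise_polynomial (a k) (b k) (u k))
    (cond : forall i : 'I_n,
      (us <= trace_in b u i /\ forall j : 'I_m, trace_out a u j <= us) \/
      (trace_in b u i < us /\
       exists ut : R, [/\ us < ut, f ut = f (trace_in b u i) &
         forall j : 'I_m, trace_out a u j <= ut])) :
  forall j : 'I_m, distribution_error alpha f us a b u j = 0.
Proof.
apply: (distribution_error_eq0 _ _ _ _ _ _ _ _ _
  (fun i => f_in f us (trace_in b u i))) => // i j.
apply: godunov_free_flow.
case: (cond i) => [[_ /(_ j) out_us]|[in_us [ut [us_ut fut /(_ j) out_ut]]]].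
  (* Condition 1: the outgoing road is uncongested, so its capacity is the maximal flux [f us]. *)
  by rewrite /f_out out_us; apply: f_in_le_max.
(* Condition 2: [ut] is the congested density carrying the same flux as the incoming trace, so the
   demand is rewritten as [f ut] to be compared with the capacity on the decreasing branch. *)
by rewrite /f_in in_us -fut; apply: f_out_ge.
Qed.
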